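(* Let $k$ be an odd positive integer and let $P$ be a $3k$-reflexive polygon. Let $Q:=\mathrm{conv}\{\pm(0,1),\pm(1,1),\pm(1,0)\}\subset\mathbb{Q}^2$. Then there is an integer $i$ with $0<i<3k$ and $\gcd(i,3k)=1$ such that $P$ is isomorphic to the image of $Q$ under right multiplication of row vectors with the matrix $$\begin{pmatrix}3k&i\\0&1\end{pmatrix}.$$ Furthermore, $P\cong 3kP^*$.
   Context: Let $N\cong\mathbb{Z}^2$ and $M=\mathrm{Hom}(N,\mathbb{Z})$. A nonzero lattice point $x$ is primitive if the segment from $\mathbf{0}$ to $x$ contains no lattice points other than its endpoints. For a positive integer $l$, a 2-dimensional convex lattice polygon $P\subset N_{\mathbb{Q}}$ containing the origin in its interior is $l$-reflexive if its vertices are primitive and for every edge $F$ the local index $l_F$ equals $l$, where $l_F$ is the positive integer with $F=\{x\in P\mid\langle u_F,x\rangle=l_F\}$ for $u_F\in M$ the primitive outer normal of $F$. The dual is $P^*=\{y\in M_{\mathbb{Q}}\mid\langle y,x\rangle\le1\ \forall x\in P\}$; for $P$ $l$-reflexive, $lP^*$ is a lattice polygon with respect to $M$. Two lattice polygons, in lattices $N$ and $N'$, are isomorphic ($\cong$) if there is an affine lattice isomorphism $N\cong N'$ mapping the vertex set of one onto that of the other. *)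

(* Defs.v *)
From mathcomp Require Import all_boot all_order all_algebra.
From mathcomp Require Import classical_sets.

Set Implicit Arguments.
Unset Strict Implicit.
Unset Printing Implicit Defensive.

Import Order.TTheory GRing.Theory Num.Theory.

Local Open Scope ring_scope.
Local Open Scope classical_set_scope.

(* A basis of N is fixed, so that N = Z^2, and M = Hom(N, Z) is identified with
   Z^2 by the dual basis. Elements of both lattices, and of N_Q and M_Q, are
   row vectors; the evaluation of y in M_Q at x in N_Q is [pairing y x]. *)
Definition ratv (x : 'rV[int]_2) : 'rV[rat]_2 := map_mx intr x.

Definition pairing (y x : 'rV[rat]_2) : rat := \sum_j y 0 j * x 0 j.

Definition vec2 (R : Type) (a b : R) : 'rV[R]_2 :=
  \row_j (if j == 0 then a else b).

Definition mat2 (R : Type) (a b c d : R) : 'M[R]_2 :=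
  \matrix_(i, j) (if i == 0 then vec2 a b 0 j else vec2 c d 0 j).

Definition conv (s : seq 'rV[rat]_2) : set 'rV[rat]_2 :=
  [set x | exists w : 'I_(size s) -> rat,
     [/\ forall i, 0 <= w i, \sum_i w i = 1 & x = \sum_i w i *: s`_i]].

Definition primitive (x : 'rV[int]_2) : Prop :=
  x != 0 /\
  forall (y : 'rV[int]_2) (t : rat),
    0 <= t <= 1 -> ratv y = t *: ratv x -> y = 0 \/ y = x.

(* Polygons are possibly degenerate here; an l-reflexive polygon is
   2-dimensional because the origin is an interior point of it. *)
Definition lattice_polygon (P : set 'rV[rat]_2) : Prop :=
  exists s : seq 'rV[int]_2, P = conv [seq ratv x | x <- s].

(* The origin lies in the topological interior of P in Q^2. *)
Definition origin_interior (P : set 'rV[rat]_2) : Prop :=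
  exists2 e : rat, 0 < e &
    forall x : 'rV[rat]_2, (forall j, `|x 0 j| < e) -> P x.

Definition supports (P F : set 'rV[rat]_2) (u : 'rV[rat]_2) (c : rat) : Prop :=
  (forall x, P x -> pairing u x <= c) /\ F = P `&` [set x | pairing u x = c].

Definition face (P F : set 'rV[rat]_2) : Prop :=
  exists u c, supports P F u c.

Definition vertex (P : set 'rV[rat]_2) (v : 'rV[rat]_2) : Prop :=
  face P [set v].

(* An edge is a face whose affine hull is a line. *)
Definition edge (P F : set 'rV[rat]_2) : Prop :=
  face P F /\
  exists x y, [/\ F x, F y, x != y &
    forall z, F z -> exists t : rat, z = x + t *: (y - x)].

Definition primitive_outer_normal (P F : set 'rV[rat]_2) (u : 'rV[int]_2) :
    Prop :=
  primitive u /\ exists c, supports P F (ratv u) c.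

(* An edge of a 2-dimensional lattice polygon has exactly one primitive outer
   normal, so the existential quantifier selects u_F. *)
Definition local_index (P F : set 'rV[rat]_2) (l : nat) : Prop :=
  (0 < l)%N /\
  exists2 u, primitive_outer_normal P F u &
    F = [set x | P x /\ pairing (ratv u) x = l%:R].

Definition reflexive_polygon (l : nat) (P : set 'rV[rat]_2) : Prop :=
  [/\ (0 < l)%N, lattice_polygon P, origin_interior P,
      forall v, vertex P v -> exists2 x, primitive x & v = ratv x &
      forall F, edge P F -> local_index P F l].

Definition dual (P : set 'rV[rat]_2) : set 'rV[rat]_2 :=
  [set y | forall x, P x -> pairing y x <= 1].

(* The affine isomorphisms Z^2 -> Z^2 are the maps x |-> x A + b with A in
   GL_2(Z) (note that [unitmx] is taken over int) and b in Z^2. *)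
Definition isomorphic (P P' : set 'rV[rat]_2) : Prop :=
  exists (A : 'M[int]_2) (b : 'rV[int]_2), A \in unitmx /\
    vertex P' = [set v *m map_mx intr A + ratv b | v in vertex P].

Definition hexagon : set 'rV[rat]_2 :=
  conv [:: vec2 0 1; - vec2 0 1; vec2 1 1; - vec2 1 1; vec2 1 0; - vec2 1 0].

(* Main.v *)
(** Every edge of [P] spans, together with one of its vertices [v], a sublattice
    of index [l]; since [v] is primitive and both edges at [v] have height [l],
    neighbouring edges span the same sublattice. So [P] is an ordinary reflexive
    polygon for that sublattice, and when [3] divides [l] no vertex and no edge
    direction may become divisible by [3] in the big lattice. Modulo [3] this
    leaves one of the two nonzero residues for [e] relative to [v] along each
    edge, which together with convexity forces every edge, and then every dual
    edge, to have lattice length [1]. Walking around six such edges closes up to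
    the hexagon with vertices [v, v + e, e, - v, - v - e, - e]; it is cut out by
    the inequalities [|det x f| <= l] for [f] in [v, e, v + e], so its scaled
    dual is its image under the rotation by a right angle. *)

Require Import Defs.
From mathcomp Require Import all_boot all_order all_algebra.
From mathcomp Require Import boolp classical_sets.
From mathcomp Require Import zify ring lra.

Import Order.TTheory GRing.Theory Num.Theory.

Local Open Scope ring_scope.
Local Open Scope classical_set_scope.

(** * Planar linear algebra and convex hulls of finite lists *)

Definition dot2 {R : comPzRingType} (x y : 'rV[R]_2) : R :=
  x 0 0 * y 0 0 + x 0 1 * y 0 1.

Definition det2 {R : comPzRingType} (x y : 'rV[R]_2) : R :=
  x 0 0 * y 0 1 - x 0 1 * y 0 0.

Lemma row2P {R : Type} (x y : 'rV[R]_2) :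
  x 0 0 = y 0 0 -> x 0 1 = y 0 1 -> x = y.
Proof.
move=> h0 h1; apply/rowP=> j; case: (unliftP ord0 j) => [j'|] ->.
  by rewrite (_ : lift ord0 j' = 1) //; apply/val_inj; rewrite /= (ord1 j').
by [].
Qed.

Lemma pairingE (y x : 'rV[rat]_2) : pairing y x = dot2 y x.
Proof.
rewrite /pairing /dot2 !big_ord_recl big_ord0 addr0.
by rewrite (_ : lift ord0 ord0 = 1) //; apply/val_inj.
Qed.

Lemma vec2E {R : Type} (a b : R) : (vec2 a b 0 0 = a) * (vec2 a b 0 1 = b).
Proof. by split; rewrite mxE. Qed.

Lemma dot2_ratv (x y : 'rV[int]_2) :
  dot2 (ratv x) (ratv y) = (dot2 x y)%:~R.
Proof. by rewrite /dot2 !mxE rmorphD !rmorphM. Qed.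

Lemma det2_ratv (x y : 'rV[int]_2) :
  det2 (ratv x) (ratv y) = (det2 x y)%:~R.
Proof. by rewrite /det2 !mxE rmorphB !rmorphM. Qed.

Lemma ratv_inj : injective ratv.
Proof.
move=> x y h; apply: row2P.
  by have := congr1 (fun z : 'rV_2 => z 0 0) h; rewrite !mxE => /intr_inj.
by have := congr1 (fun z : 'rV_2 => z 0 1) h; rewrite !mxE => /intr_inj.
Qed.

Lemma det2_comb {R : comPzRingType} (x y : 'rV[R]_2) (a b c d : R) :
  det2 (a *: x + b *: y) (c *: x + d *: y) = (a * d - b * c) * det2 x y.
Proof. rewrite /det2 !mxE; ring. Qed.

Lemma conv_mem (s : seq 'rV[rat]_2) (z : 'rV[rat]_2) : z \in s -> conv s z.
Proof.
move=> zs; have iz : (index z s < size s)%N by rewrite index_mem.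
exists (fun i => (i == Ordinal iz)%:R); split.
- by move=> i; rewrite ler0n.
- by rewrite (bigD1 (Ordinal iz)) //= eqxx big1 ?addr0 // => i /negPf ->.
rewrite (bigD1 (Ordinal iz)) //= eqxx scale1r nth_index // big1 ?addr0 //
  => i /negPf ->.
by rewrite scale0r.
Qed.

Lemma conv_comb (s : seq 'rV[rat]_2) (x y : 'rV[rat]_2) (t : rat) :
  conv s x -> conv s y -> 0 <= t <= 1 -> conv s ((1 - t) *: x + t *: y).
Proof.
move=> [w [w0 w1 ->]] [w' [w0' w1' ->]] /andP[t0 t1].
exists (fun i => (1 - t) * w i + t * w' i); split.
- by move=> i; rewrite addr_ge0 ?mulr_ge0 ?subr_ge0.
- by rewrite big_split /= -!mulr_sumr w1 w1'; ring.
rewrite !scaler_sumr -big_split /=; apply: eq_bigr => i _.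
by rewrite !scalerA -scalerDl.
Qed.

Lemma dot2_sumr {R : comPzRingType} (I : finType) (u : 'rV[R]_2)
    (w : I -> R) (f : I -> 'rV[R]_2) :
  dot2 u (\sum_i w i *: f i) = \sum_i w i * dot2 u (f i).
Proof.
rewrite /dot2 !summxE !mulr_sumr -big_split /=; apply: eq_bigr => i _.
rewrite !mxE; ring.
Qed.

Lemma conv_le (s : seq 'rV[rat]_2) (u x : 'rV[rat]_2) (c : rat) :
  (forall p, p \in s -> dot2 u p <= c) -> conv s x -> dot2 u x <= c.
Proof.
move=> h [w [w0 w1 ->]]; rewrite dot2_sumr -[c]mul1r -w1 mulr_suml.
by apply: ler_sum => i _; rewrite ler_wpM2l // h // mem_nth.
Qed.

(** The weighted gaps to the maximum are nonnegative and sum to zero, so every point other than [v]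
    carries weight zero. *)
Lemma conv_eq (s : seq 'rV[rat]_2) (u x v : 'rV[rat]_2) :
  (forall p, p \in s -> p != v -> dot2 u p < dot2 u v) ->
  conv s x -> dot2 u x = dot2 u v -> x = v.
Proof.
move=> h [w [w0 w1 ->]]; rewrite dot2_sumr => e.
have h' p : p \in s -> dot2 u p <= dot2 u v.
  by move=> ps; have [->//|/(h _ ps)/ltW] := eqVneq p v.
have : \sum_i w i * (dot2 u v - dot2 u s`_i) = 0.
  transitivity ((\sum_i w i) * dot2 u v - \sum_i w i * dot2 u s`_i).
    by rewrite mulr_suml -sumrB; apply: eq_bigr => i _; rewrite mulrBr.
  by rewrite e w1 mul1r subrr.
move/eqP; rewrite psumr_eq0 => [/allP k|i _]; last first.
  by rewrite mulr_ge0 // subr_ge0 h' // mem_nth.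
have {}k i : w i *: s`_i = w i *: v.
  have := k i (mem_index_enum _); rewrite /= mulf_eq0 => /orP[/eqP->|].
    by rewrite !scale0r.
  have [->//|/(h _ (mem_nth _ (ltn_ord i)))] := eqVneq s`_i v.
  by rewrite subr_eq0 => /lt_eqF h1 /eqP h2; rewrite h2 eqxx in h1.
by rewrite (eq_bigr _ (fun i _ => k i)) -scaler_suml w1 scale1r.
Qed.

(** A small positive multiple of [u] lies in the polygon and pairs positively with [u]; this is
    impossible if [u] is nonpositive on all generators. *)
Lemma conv_interior (s : seq 'rV[int]_2) (u : 'rV[int]_2) :
  origin_interior (conv [seq ratv x | x <- s]) -> u != 0 ->
  exists2 w, w \in s & 0 < dot2 u w.
Proof.
move=> [e e0 he] u0; apply/hasP; apply: contraT => /hasPn hs.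
(* [b] exceeds both coordinates of [u] in absolute value, so those of [e / b] times [u] stay below
   [e]. *)
pose b : rat := 1 + `|(u 0 0)%:~R| + `|(u 0 1)%:~R|.
have n0 := normr_ge0 ((u 0 0)%:~R : rat).
have n1 := normr_ge0 ((u 0 1)%:~R : rat).
have b0 : 0 < b by rewrite /b; lra.
pose t := e / b; have t0 : 0 < t by rewrite divr_gt0.
have tb : t * b = e by rewrite mulfVK // gt_eqF.
have /he Px : forall j, `|(t *: ratv u) 0 j| < e.
  move=> j; rewrite !mxE normrM (gtr0_norm t0) -tb ltr_pM2l // /b.
  case: (unliftP ord0 j) => [j'|] -> /=; last first.
    have -> : ord0 = 0 :> 'I_2 by []. lra.
  rewrite (_ : lift ord0 j' = 1); last by apply/val_inj; rewrite /= (ord1 j').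
  by lra.
have: dot2 (ratv u) (t *: ratv u) <= 0.
  apply: conv_le Px => _ /mapP[w ws ->]; rewrite dot2_ratv.
  by rewrite -[0]/(0%:~R) ler_int leNgt hs.
rewrite (_ : dot2 _ _ = t * (dot2 u u)%:~R); last first.
  by rewrite -dot2_ratv /dot2 !mxE; ring.
rewrite pmulr_rle0 // -[0 in X in X -> _]/(0%:~R) ler_int => h.
have /eqP[] := u0.
have sq (p q : int) : p * p + q * q <= 0 -> p = 0 /\ q = 0.
  have := sqr_ge0 p; have := sqr_ge0 q; rewrite !expr2 => *; nia.
by have [h1 h2] := sq _ _ h; apply: row2P; rewrite mxE.
Qed.

(** * Primitive lattice points *)

Definition unimodular (x : 'rV[int]_2) : Prop := exists a, dot2 a x = 1.

(** Bezout reaches the gcd [g] of the coordinates. The point [x / g] is a lattice point on the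
    segment from the origin to [x], and primitivity leaves only [g = 1]. *)
Lemma primitive_unimodular (x : 'rV[int]_2) : primitive x -> unimodular x.
Proof.
move=> [x0 h]; have [a [b hab]] := Bezoutz (x 0 0) (x 0 1).
set g := gcdz _ _ in hab.
have g0 : 0 < g.
  rewrite lt0r andbT gcdz_eq0; apply: contra x0.
  by move=> /andP[/eqP p /eqP q]; apply/eqP/row2P; rewrite mxE.
have g0' : 0 < g%:~R :> rat by rewrite ltr0z.
have /dvdzP[p hp] : dvdz g (x 0 0) by apply: dvdz_gcdl.
have /dvdzP[q hq] : dvdz g (x 0 1) by apply: dvdz_gcdr.
exists (vec2 a b); rewrite /dot2 !vec2E hab.
have [] := h (vec2 p q) (g%:~R^-1).
- by rewrite invr_ge0 ltW //= invf_le1 // -[1]/(1%:~R) ler_int; lia.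
- by apply: row2P; rewrite !mxE /= ?hp ?hq rmorphM /= mulrC mulfK ?gt_eqF.
- move=> e; case/eqP: x0; apply: row2P; rewrite mxE ?hp ?hq.
    by have := congr1 (fun z : 'rV_2 => z 0 0) e; rewrite vec2E mxE => ->; ring.
  by have := congr1 (fun z : 'rV_2 => z 0 1) e; rewrite vec2E mxE => ->; ring.
move=> e.
have e1 := congr1 (fun z : 'rV_2 => z 0 0) e.
have e2 := congr1 (fun z : 'rV_2 => z 0 1) e.
move: e1 e2 hp hq hab; rewrite !vec2E /= => -> ->.
move=> hp hq hab; move: x0.
have [//|g1] := eqVneq g 1.
have key (t : int) : t = t * g -> t = 0.
  move=> ht; have /eqP : t * (g - 1) = 0 by rewrite mulrBr -ht; ring.
  by rewrite mulf_eq0 subr_eq0 (negPf g1) orbF => /eqP.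
by case/eqP; apply: row2P; rewrite mxE; apply: key.
Qed.

Lemma unimodular_parallel (x y : 'rV[int]_2) :
  unimodular x -> det2 x y = 0 -> exists t, y = t *: x.
Proof.
move=> [a ha] h; exists (dot2 a y).
have k0 : y 0 0 * dot2 a x = dot2 a y * x 0 0 - a 0 1 * det2 x y.
  by rewrite /dot2 /det2; ring.
have k1 : y 0 1 * dot2 a x = dot2 a y * x 0 1 + a 0 0 * det2 x y.
  by rewrite /dot2 /det2; ring.
move: k0 k1; rewrite ha h !mulr1 !mulr0 subr0 addr0 => k0 k1.
by apply: row2P; rewrite !mxE.
Qed.

(** * Vertices and gift wrapping *)

Lemma seq_max {T : eqType} (f : T -> int) (s : seq T) (x : T) :
  x \in s -> exists2 v, v \in s & forall w, w \in s -> f w <= f v.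
Proof.
elim: s x => [//|a [|b s] IH] x _.
  by exists a => [|w]; rewrite mem_seq1 // => /eqP ->.
have [v vs hv] := IH b (mem_head _ _).
have [fav|fva] := leP (f a) (f v).
  exists v => [|w]; first by rewrite in_cons vs orbT.
  by rewrite in_cons => /orP[/eqP -> //|/hv].
exists a => [|w]; first exact: mem_head.
by rewrite in_cons => /orP[/eqP -> //|/hv /le_trans -> //]; apply: ltW.
Qed.

Definition strict_max (s : seq 'rV[int]_2) (u v : 'rV[int]_2) : Prop :=
  v \in s /\ forall w, w \in s -> w != v -> dot2 u w < dot2 u v.

(* A point of maximal norm works, by Cauchy-Schwarz. *)
Lemma strict_max_exists (s : seq 'rV[int]_2) (x : 'rV[int]_2) :
  x \in s -> exists u v, strict_max s u v.
Proof.
move=> /(seq_max (fun x => dot2 x x))[v vs hv].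
exists v, v; split=> // w ws wv.
have : 0 < dot2 (w - v) (w - v).
  have pos (a b : int) : 0 <= a * a + b * b.
    by rewrite addr_ge0 // -expr2 sqr_ge0.
  rewrite lt0r pos andbT; apply: contra wv => /eqP; rewrite /dot2 !mxE => h.
  have sq (p q : int) : p * p + q * q = 0 -> p = 0 /\ q = 0.
    have := sqr_ge0 p; have := sqr_ge0 q; rewrite !expr2 => *; nia.
  by have [h1 h2] := sq _ _ h; apply/eqP/row2P; apply/eqP; rewrite -subr_eq0;
    apply/eqP.
have -> : dot2 (w - v) (w - v) = dot2 w w + dot2 v v - 2 * dot2 v w.
  by rewrite /dot2 !mxE; ring.
by have := hv w ws; lia.
Qed.

(** This is [u] applied to the linear relation between three vectors of the plane. *)
Lemma det2_dot2 {R : comPzRingType} (u x y z : 'rV[R]_2) :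
  dot2 u y * det2 x z = dot2 u z * det2 x y + dot2 u x * det2 y z.
Proof. rewrite /dot2 /det2; ring. Qed.

(** Transitivity of the angular order around a vertex, ties being broken by distance. The [h]'s are
    heights relative to the vertex and the [d]'s are determinants; [h3 = 0] admits the vertex itself
    as third point. *)
Lemma gift_step (h1 h2 h3 d12 d23 d13 : int) :
  h1 < 0 -> h2 < 0 -> h3 <= 0 -> h2 * d13 = h3 * d12 + h1 * d23 ->
  0 <= d12 -> (d12 = 0 -> h1 < h2) -> 0 <= d23 -> (d23 = 0 -> h2 <= h3) ->
  0 <= d13 /\ (d13 = 0 -> h1 <= h3).
Proof.
move=> n1 n2 n3 e p12 t12 p23 t23; split; first by nia.
move=> z13; rewrite z13 mulr0 in e.
have z23 : d23 = 0 by nia.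
have {}t23 := t23 z23.
have [z12|nz12] := eqVneq d12 0; first by have := t12 z12; lia.
have : h3 = 0 by nia.
lia.
Qed.

(** The end of the counterclockwise edge at [v]: all points lie to the left of the ray through [v'].
    As [u] peaks at [v], a smaller value of [u] on this ray means farther from [v], so [v'] is the
    far end. *)
Definition next_vertex (s : seq 'rV[int]_2) (u v v' : 'rV[int]_2) : Prop :=
  [/\ v' \in s, v' != v & forall w, w \in s ->
    0 <= det2 (v' - v) (w - v) /\
    (det2 (v' - v) (w - v) = 0 -> dot2 u v' <= dot2 u w)].

Lemma next_vertex_exists (s : seq 'rV[int]_2) (u v x : 'rV[int]_2) :
  (forall w, w \in s -> w != v -> dot2 u w < dot2 u v) ->
  x \in s -> x != v -> exists v', next_vertex s u v v'.
Proof.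
elim: s x => [//|a s IH] x hu xs xv.
have det0 (m : 'rV[int]_2) : det2 m (v - v) = 0.
  by rewrite subrr /det2 !mxE; ring.
have detC (m m' : 'rV[int]_2) : det2 m m' = - det2 m' m.
  by rewrite /det2; ring.
have hs w : w \in s -> w != v -> dot2 u w < dot2 u v.
  by move=> ws; apply: hu; rewrite in_cons ws orbT.
have dB (p q : 'rV[int]_2) : dot2 u (p - q) = dot2 u p - dot2 u q.
  by rewrite /dot2 !mxE; ring.
have [/hasP[y ys yv]|/hasPn sv] := boolP (has (fun w => w != v) s).
  have [v' [v's v'v hv']] := IH y hs ys yv.
  have [av|av] := eqVneq a v.
    exists v'; split=> // [|w]; first by rewrite in_cons v's orbT.
    rewrite in_cons => /orP[/eqP ->|/hv' //]; rewrite av det0; split=> // _.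
    exact/ltW/hs.
  have ha : dot2 u a < dot2 u v by apply: hu => //; apply: mem_head.
  have hv : dot2 u v' < dot2 u v by apply: hs.
  set D := det2 (v' - v) (a - v).
  have [keep|swap] : (0 <= D /\ (D = 0 -> dot2 u v' <= dot2 u a)) \/
      (0 <= - D /\ (- D = 0 -> dot2 u a < dot2 u v')).
    by have := eqVneq D 0; have := leP (dot2 u v') (dot2 u a); lia.
    exists v'; split=> // [|w]; first by rewrite in_cons v's orbT.
    by rewrite in_cons => /orP[/eqP ->|/hv'].
  exists a; split=> // [|w]; first exact: mem_head.
  rewrite in_cons => /orP[/eqP ->|ws]; first by rewrite /det2; split; lia.
  have [p t] := hv' w ws; case: swap => p' t'.
  have hw : dot2 u w <= dot2 u v.
    by have [->|/(hs w ws)/ltW] := eqVneq w v.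
  have := @gift_step (dot2 u (a - v)) (dot2 u (v' - v)) (dot2 u (w - v))
    (- D) (det2 (v' - v) (w - v)) (det2 (a - v) (w - v)).
  rewrite det2_dot2 /D (detC (a - v) (v' - v)) !dB.
  by case=> //; try lia; move=> *; split=> // *; lia.
exists a; have sv' w : w \in s -> w = v by move=> /sv; rewrite negbK => /eqP.
have av : a != v.
  by move: xs; rewrite in_cons => /orP[/eqP <- //|/sv' e]; rewrite e eqxx in xv.
split=> // [|w]; first exact: mem_head.
rewrite in_cons => /orP[/eqP ->|/sv' ->]; first by rewrite /det2; split; lia.
by rewrite det0; split=> // _; apply/ltW/hu => //; apply: mem_head.
Qed.

(* Tilting the normal of the edge from [v] to [v'] exposes [v']. *)
Lemma next_vertex_strict_max (s : seq 'rV[int]_2) (u v v' : 'rV[int]_2) :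
  strict_max s u v -> next_vertex s u v v' -> exists u', strict_max s u' v'.
Proof.
move=> [vs hu] [v's v'v hv'].
have [x xs hx] := seq_max (fun w => - dot2 u w) s v' v's.
(* The new functional is [- K * det2 m z - dot2 u z]. Its first term peaks on the edge line and its
   second selects the far end; [x] minimizes [u], so one unit of determinant times [K] outweighs any
   gain in the second term. *)
pose K := 1 + dot2 u v' - dot2 u x.
pose m := v' - v.
exists (vec2 (K * m 0 1 - u 0 0) (- K * m 0 0 - u 0 1)); split=> // w ws wv'.
have E z : dot2 (vec2 (K * m 0 1 - u 0 0) (- K * m 0 0 - u 0 1)) z =
    - K * det2 m (z - v) - dot2 u z - K * det2 m v.
  by rewrite /dot2 /det2 !vec2E !mxE; ring.
rewrite !E; have [p t] := hv' w ws.
have z' : det2 m (v' - v) = 0 by rewrite /det2 -/m; ring.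
rewrite -/m in p t; rewrite z'.
have hxw := hx w ws; have hxv := hx v' v's.
have [z|nz] := eqVneq (det2 m (w - v)) 0; last first.
  have : 1 <= det2 m (w - v) by lia.
  rewrite /K; move: (det2 m _) => D; nia.
rewrite z; suff : dot2 u w != dot2 u v' by have := t z; lia.
apply: contra wv' => /eqP e.
have h := hu v' v's v'v.
(* [u] and [det2 m] are independent since [u] is not constant along [m]; a point with the same two
   values as [v'] is therefore [v']. *)
have [i0 i1] : (dot2 u v' - dot2 u v) * (w 0 0 - v' 0 0) = 0 /\
    (dot2 u v' - dot2 u v) * (w 0 1 - v' 0 1) = 0.
  have ez : dot2 u w - dot2 u v' = 0 by rewrite e subrr.
  split.
    transitivity (- u 0 1 * det2 m (w - v) + m 0 0 * (dot2 u w - dot2 u v')).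
      by rewrite /m /det2 /dot2 !mxE; ring.
    by rewrite z ez; ring.
  transitivity (u 0 0 * det2 m (w - v) + m 0 1 * (dot2 u w - dot2 u v')).
    by rewrite /m /det2 /dot2 !mxE; ring.
  by rewrite z ez; ring.
have nz : dot2 u v' - dot2 u v != 0 by lia.
by move/eqP: i0; move/eqP: i1; rewrite !mulf_eq0 (negPf nz) !subr_eq0 /=
  => /eqP ? /eqP ?; apply/eqP/row2P.
Qed.

(** * Edges of a reflexive polygon *)

Definition lattice_hull (s : seq 'rV[int]_2) : set 'rV[rat]_2 :=
  conv [seq ratv x | x <- s].

Lemma lattice_hull_mem (s : seq 'rV[int]_2) (v : 'rV[int]_2) :
  v \in s -> lattice_hull s (ratv v).
Proof. by move=> vs; apply/conv_mem/map_f. Qed.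

Lemma lattice_hull_le (s : seq 'rV[int]_2) (u : 'rV[int]_2) (c : int) x :
  (forall w, w \in s -> dot2 u w <= c) -> lattice_hull s x ->
  dot2 (ratv u) x <= c%:~R.
Proof.
move=> h; apply: conv_le => _ /mapP[w ws ->].
by rewrite dot2_ratv ler_int h.
Qed.

Lemma strict_max_vertex (s : seq 'rV[int]_2) (u v : 'rV[int]_2) :
  strict_max s u v -> vertex (lattice_hull s) (ratv v).
Proof.
move=> [vs hu]; exists (ratv u), (dot2 u v)%:~R; split.
  move=> x Px; rewrite pairingE; apply: lattice_hull_le Px => w ws.
  by have [->//|/(hu w ws)/ltW] := eqVneq w v.
apply/seteqP; split=> [x ->|x /= [Px]]; rewrite /= pairingE -dot2_ratv.
  by split=> //; apply: lattice_hull_mem.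
apply: conv_eq Px => _ /mapP[w ws ->] wv; rewrite !dot2_ratv ltr_int hu //.
by apply: contra wv => /eqP ->.
Qed.

(** An edge traversed counterclockwise: [c] is its lattice length, [e] its primitive direction, and
    [det2 _ e] its outer normal, of height [l]. The field [stop_vertex] allows the construction to
    be repeated at the other end. *)
Record edge_data (l : nat) (s : seq 'rV[int]_2) (v : 'rV[int]_2) (c : int)
    (e : 'rV[int]_2) : Prop := EdgeData {
  start_mem : v \in s;
  stop_mem : v + c *: e \in s;
  length_pos : 0 < c;
  start_unimodular : unimodular v;
  direction_unimodular : unimodular e;
  edge_height : det2 v e = l%:Z;
  edge_support : forall x, lattice_hull s x -> det2 x (ratv e) <= l%:R;
  edge_end : forall t, v + t *: e \in s -> t <= c;
  stop_vertex : exists u, strict_max s u (v + c *: e) }.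

(** Gift wrapping finds the far end [v']. The resulting face is an edge, so reflexivity supplies a
    primitive normal [w] of height [l], and a quarter turn of [w] gives the direction [e]. *)
Lemma edge_data_exists (l : nat) (s : seq 'rV[int]_2) (u v : 'rV[int]_2) :
  reflexive_polygon l (lattice_hull s) -> strict_max s u v ->
  exists c e, edge_data l s v c e.
Proof.
move=> [l0 _ hO hV hE] hv.
have [vs hu] := hv.
have uv : unimodular v.
  have [x /primitive_unimodular px /ratv_inj ->//] :=
    hV _ (strict_max_vertex s u v hv).
have v0 : v != 0.
  by apply/eqP=> e; case: uv => a; rewrite e /dot2 !mxE !mulr0.
have [x xs xv] : exists2 x, x \in s & x != v.
  have [|x xs hx] := conv_interior s (- v) hO; first by rewrite oppr_eq0.
  exists x => //; apply/eqP => e; move: hx.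
  have -> : dot2 (- v) x = - (v 0 0 ^+ 2 + v 0 1 ^+ 2).
    by rewrite e /dot2 !mxE; ring.
  by rewrite oppr_gt0 ltNge addr_ge0 ?sqr_ge0.
have [v' nv'] := next_vertex_exists s u v x hu xs xv.
have sv' := next_vertex_strict_max s u v v' hv nv'.
have [v's v'v hv'] := nv'.
have [m mV] : exists m, m = v' - v by eexists.
rewrite -mV in hv'.
pose n := vec2 (m 0 1) (- m 0 0).
have nE w : dot2 n w = det2 w m.
  by rewrite /dot2 /det2 !vec2E; ring.
have nm : dot2 n v' = dot2 n v by rewrite !nE mV /det2 !mxE; ring.
have nle w : w \in s -> dot2 n w <= dot2 n v.
  move=> /hv'[+ _]; suff -> : det2 m (w - v) = dot2 n v - dot2 n w by lia.
  by rewrite !nE /det2 !mxE; ring.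
have m0 : m != 0 by rewrite mV subr_eq0.
have n0 : n != 0.
  apply: contra m0 => /eqP e.
  have e0 := congr1 (fun z : 'rV_2 => z 0 0) e.
  have e1 := congr1 (fun z : 'rV_2 => z 0 1) e.
  move: e0 e1; rewrite !vec2E !mxE => e0 e1.
  by apply/eqP/row2P; rewrite !mxE; lia.
pose F := lattice_hull s `&` [set x | pairing (ratv n) x = (dot2 n v)%:~R].
have Fmem w : w \in s -> dot2 n w = dot2 n v -> F (ratv w).
  move=> ws e; split; first exact: lattice_hull_mem.
  by rewrite /= pairingE dot2_ratv e.
have eF : edge (lattice_hull s) F.
  split.
    exists (ratv n), (dot2 n v)%:~R; split=> // z Pz.
    by rewrite pairingE; apply: lattice_hull_le Pz.
  exists (ratv v), (ratv v'); split.
  - exact: Fmem.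
  - exact: Fmem.
  - by apply: contra v'v => /eqP/ratv_inj ->.
  move=> z [_]; rewrite /= pairingE -dot2_ratv => ez.
  have d0 : det2 (ratv m) (z - ratv v) = 0.
    transitivity (dot2 (ratv n) (ratv v) - dot2 (ratv n) z); last first.
      by rewrite ez subrr.
    by rewrite /dot2 /det2 !mxE /= rmorphN; ring.
  have mE : ratv v' - ratv v = ratv m.
    by apply: row2P; rewrite mV !mxE rmorphB.
  have zE j : z 0 j = ratv v 0 j + (z - ratv v) 0 j by rewrite !mxE; ring.
  rewrite mE.
  have [z0|nz0] := eqVneq (m 0 0) 0.
    have nz1 : (m 0 1)%:~R != 0 :> rat.
      rewrite intr_eq0; apply: contra m0 => /eqP z1.
      by apply/eqP/row2P; rewrite [RHS]mxE.
    exists ((z - ratv v) 0 1 / (m 0 1)%:~R).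
    move: d0; rewrite /det2 mxE z0 mul0r add0r => /eqP.
    rewrite oppr_eq0 [ratv m 0 1]mxE mulf_eq0 (negPf nz1) => /eqP d0.
    apply: row2P; rewrite zE.
      by rewrite d0 !mxE z0 mulr0z mulr0.
    by rewrite [RHS]mxE [X in _ = _ + X]mxE [ratv m _ _]mxE divfK.
  have nz1 : (m 0 0)%:~R != 0 :> rat by rewrite intr_eq0.
  exists ((z - ratv v) 0 0 / (m 0 0)%:~R).
  apply: row2P; rewrite zE.
    by rewrite [RHS]mxE [X in _ = _ + X]mxE [ratv m _ _]mxE divfK.
  rewrite [RHS]mxE [X in _ = _ + X]mxE [ratv m _ _]mxE; congr (_ + _).
  apply: (mulfI nz1); move/eqP: d0; rewrite /det2 subr_eq0.
  rewrite ![ratv m _ _]mxE => /eqP ->.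
  by field.
have [_ [w [pw [c0 [cle Fc]]] Fl]] := hE F eF.
have Fv : F (ratv v) by apply: Fmem.
have Fv' : F (ratv v') by apply: Fmem.
have wv : dot2 w v = l%:Z.
  move: Fv; rewrite Fl => -[_ /=]; rewrite pairingE dot2_ratv => h.
  by apply: (@intr_inj rat); rewrite h.
have wv' : dot2 w v' = l%:Z.
  move: Fv'; rewrite Fl => -[_ /=]; rewrite pairingE dot2_ratv => h.
  by apply: (@intr_inj rat); rewrite h.
(* [local_index] names the supporting constant and the height separately; evaluating at [v]
   identifies them. *)
have c0l : c0 = l%:R.
  move: (Fv); rewrite Fc => -[_ /= <-]; rewrite pairingE dot2_ratv wv.
  by [].
pose e := vec2 (- w 0 1) (w 0 0).
have dE z : det2 z e = dot2 w z by rewrite /det2 /dot2 !vec2E; ring.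
have ue : unimodular e.
  have [a ha] := primitive_unimodular w pw.
  exists (vec2 (- a 0 1) (a 0 0)); rewrite -ha /dot2 !vec2E; ring.
have [c hc] : exists c, m = c *: e.
  apply: unimodular_parallel => //.
  have -> : det2 e m = dot2 w v - dot2 w v'.
    by rewrite mV /det2 /dot2 !vec2E !mxE; ring.
  by rewrite wv wv' subrr.
have v'E : v' = v + c *: e by rewrite -hc mV addrC subrK.
have lp : 0 < l%:Z by [].
have hve : det2 v e = l%:Z by rewrite dE.
(* The origin is interior, so [n] is positive somewhere and hence at its maximum, whose value is
   [c * l]. *)
have cpos : 0 < c.
  have [y ys hy] := conv_interior s n hO n0.
  have : 0 < dot2 n v by apply: lt_le_trans hy (nle y ys).
  have -> : dot2 n v = c * l%:Z by rewrite nE -hve hc /det2 !mxE; ring.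
  by rewrite pmulr_lgt0.
exists c, e; split=> //.
- by rewrite -v'E.
- move=> z Pz; rewrite -c0l.
  have -> : det2 z (ratv e) = pairing (ratv w) z.
    by rewrite pairingE /det2 /dot2 !mxE /= rmorphN; ring.
  exact: cle.
- move=> t ts.
  have [_] := hv' _ ts.
  have -> : det2 m (v + t *: e - v) = 0 by rewrite hc /det2 !mxE; ring.
  move=> /(_ erefl).
  have [uv' vu] : dot2 u v' = dot2 u v + c * dot2 u e /\
      dot2 u (v + t *: e) = dot2 u v + t * dot2 u e.
    by rewrite v'E /dot2 !mxE; split; ring.
  have := hu v' v's v'v; rewrite uv' vu; nia.
by rewrite -v'E.
Qed.

(** Both edges have height [l] at the primitive point [v'], so [e' - e] is a multiple of [v']. The
    support line of the first edge makes this multiple nonpositive, and zero would prolong that edge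
    beyond its end. *)
Lemma edge_data_next (l : nat) (s : seq 'rV[int]_2) (v e e' : 'rV[int]_2)
    (c c' : int) :
  (0 < l)%N -> edge_data l s v c e -> edge_data l s (v + c *: e) c' e' ->
  exists2 d, 0 < d & e' = e - d *: (v + c *: e).
Proof.
move=> l0 E E'; set v' := v + c *: e in E' *.
have [d0 hd] : exists t, e' - e = t *: v'.
  apply: unimodular_parallel; first exact: (start_unimodular _ _ _ _ _ E').
  have -> : det2 v' (e' - e) = det2 v' e' - det2 v e.
    by rewrite /v' /det2 !mxE; ring.
  by rewrite (edge_height _ _ _ _ _ E) (edge_height _ _ _ _ _ E') subrr.
have e'E : e' = e + d0 *: v' by rewrite -hd addrC subrK.
exists (- d0); last by rewrite e'E scaleNr opprK.
have c'0 := length_pos _ _ _ _ _ E'.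
have h := edge_height _ _ _ _ _ E.
have := edge_support _ _ _ _ _ E (ratv (v' + c' *: e')).
have -> : det2 (ratv (v' + c' *: e')) (ratv e) = ((1 + c' * d0) * l%:Z)%:~R.
  by rewrite det2_ratv -h e'E; congr (_ %:~R); rewrite /v' /det2 !mxE; ring.
move=> /(_ (lattice_hull_mem _ _ (stop_mem _ _ _ _ _ E'))).
rewrite -[l%:R]/(l%:Z%:~R) ler_int => hd0.
have d0le : d0 <= 0 by nia.
have [z|] := eqVneq d0 0; last by lia.
have := edge_end _ _ _ _ _ E (c + c').
have -> : v + (c + c') *: e = v' + c' *: e'.
  by rewrite e'E z scale0r addr0 scalerDl addrA.
move=> /(_ (stop_mem _ _ _ _ _ E')); lia.
Qed.

(** * Residues modulo 3 along an edge *)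

Lemma not_unimodular3 (h : 'rV[int]_2) : ~ unimodular (3 *: h).
Proof.
move=> [a]; rewrite (_ : dot2 a (3 *: h) = 3 * dot2 a h); first by lia.
by rewrite /dot2 !mxE; ring.
Qed.

(** As 3 divides the determinant, [e] is congruent to a multiple [r] of [v], nonzero because [e] is
    primitive. Then [x *: v + y *: e] is congruent to [x + y * r] times [v]. *)
Lemma residue_mod3 (k : nat) (v e : 'rV[int]_2) :
  unimodular v -> unimodular e -> det2 v e = (3 * k)%N%:Z ->
  exists (r : int) (h : 'rV[int]_2),
    [/\ r = 1 \/ r = -1, e = r *: v + 3 *: h &
    forall x y t, unimodular (x *: v + y *: e) -> x + y * r <> 3 * t].
Proof.
move=> [a ha] ue hk.
(* [det2 v g = 1], so [v, g] is a lattice basis, in which [e] has coordinates [dot2 a e] and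
   [3 * k]. *)
pose g := vec2 (- a 0 1) (a 0 0).
have eE : e = dot2 a e *: v + 3 *: (k%:Z *: g).
  have k0 : dot2 a v * e 0 0 = dot2 a e * v 0 0 - det2 v e * a 0 1.
    by rewrite /dot2 /det2; ring.
  have k1 : dot2 a v * e 0 1 = dot2 a e * v 0 1 + det2 v e * a 0 0.
    by rewrite /dot2 /det2; ring.
  move: k0 k1; rewrite ha !mul1r hk => k0 k1.
  apply: row2P.
    by rewrite k0 ![in RHS]mxE /= PoszM; ring.
  by rewrite k1 ![in RHS]mxE /= PoszM; ring.
pose m := dot2 a e; pose q := (m %/ 3)%Z; pose r0 := (m %% 3)%Z.
have hm : m = q * 3 + r0 by apply: divz_eq.
have r0lt : 0 <= r0 < 3 by rewrite modz_ge0 // ltz_pmod.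
have [r [q' [hr hmr]]] : exists r q', (r = 1 \/ r = -1) /\ m = q' * 3 + r.
  have [z|[z|z]] : r0 = 0 \/ r0 = 1 \/ r0 = 2 by lia.
  - case: (not_unimodular3 (q *: v + k%:Z *: g)).
    rewrite (_ : _ *: _ = e) //; rewrite [in RHS]eE -/m hm z.
    by rewrite scalerDr !scalerA addr0 [3 * q]mulrC.
  - by exists 1, q; split; [left | lia].
  by exists (-1), (q + 1); split; [right | lia].
have eE' : e = r *: v + 3 *: (q' *: v + k%:Z *: g).
  by rewrite [LHS]eE -/m hmr; apply/rowP => j; rewrite !mxE; ring.
exists r, (q' *: v + k%:Z *: g); split=> // x y t u z.
apply: (not_unimodular3 (t *: v + y *: (q' *: v + k%:Z *: g))).
rewrite (_ : _ *: _ = x *: v + y *: e) //.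
rewrite [in RHS]eE' scalerDr scalerA -z.
by apply/rowP => j; rewrite !mxE; ring.
Qed.

(* [(x, y)] are the coordinates, in the basis [v, e] of an edge of lattice
   length [c], of a vertex on the other side of the origin; [d'] and [d] are
   the lattice lengths of the dual edges at its two ends. Multiplying the two
   inequalities out gives [d * d' * c <= 2 * (d + d')], and the residues leave
   nothing but [c = 1]. *)
Lemma edge_arith (c d d' x y r : int) :
  0 < c -> 0 < d -> 0 < d' -> x < 0 -> x - d' * y <= 1 ->
  x * (1 - d * c) + d * y <= 1 -> r = 1 \/ r = -1 ->
  (forall t, 1 + c * r <> 3 * t) -> (forall t, d' + r <> 3 * t) ->
  (forall t, - d + (1 - d * c) * r <> 3 * t) ->
  (forall t, x + y * r <> 3 * t) -> c = 1 /\ r = 1.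
Proof.
move=> c0 d0 d'0 x0 h1 h2 hr n1 n2 n3 n4.
have key : d * d' * c <= 2 * (d + d').
  have : d * (x - d' * y) + d' * (x * (1 - d * c) + d * y) <= d + d' by nia.
  have -> : d * (x - d' * y) + d' * (x * (1 - d * c) + d * y) =
    - x * (d * d' * c - (d + d')) by ring.
  move: (d * d' * c) => p hp; have [|q0] := leP p (d + d'); first by lia.
  have : p - (d + d') <= - x * (p - (d + d')) by rewrite ler_peMl; lia.
  lia.
have c4 : c <= 4.
  have hp : d + d' <= 2 * (d * d') by nia.
  have p0 : 0 < d * d' by rewrite mulr_gt0.
  rewrite -(ler_pM2l p0); lia.
(* For [c > 1], either the far end is divisible by 3, or [key] and the residues leave one pair
   [d, d']. That pair determines [x] and [y], and [x + y * r] is then a multiple of 3. *)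
have [c1|[c2|[c3|c4']]] : c = 1 \/ c = 2 \/ c = 3 \/ c = 4 by lia.
- by case: hr => hr; first (by []); subst c r; case: (n1 0); lia.
- subst c; exfalso; case: hr => hr; subst r; first by case: (n1 1); lia.
  have d1 : d <> 1 by move=> e; case: (n3 0); lia.
  have d1' : d' <> 1 by move=> e; case: (n2 0); lia.
  have [e e'] : d = 2 /\ d' = 2 by nia.
  by subst d d'; case: (n4 0); lia.
- subst c; exfalso; case: hr => hr; subst r.
    have d1 : d <> 1 by move=> e; case: (n3 (-1)); lia.
    have [e e'] : d = 2 /\ d' = 1 by nia.
    by subst d d'; case: (n4 (-1)); lia.
  have d1' : d' <> 1 by move=> e; case: (n2 0); lia.
  have [e e'] : d = 1 /\ d' = 2 by nia.
  by subst d d'; case: (n4 0); lia.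
subst c; exfalso; case: hr => hr; subst r; last by case: (n1 (-1)); lia.
have [e e'] : d = 1 /\ d' = 1 by nia.
by subst d d'; case: (n4 (-1)); lia.
Qed.

(** * The walk around the boundary *)

(** The closed walk is unrolled into an infinite sequence, which avoids cyclic indices and a count
    of vertices. The turn [d n] sits at [v n.+1], between edges [n] and [n.+1]. *)
Record edge_chain (l : nat) (s : seq 'rV[int]_2) (v e : nat -> 'rV[int]_2)
    (c d : nat -> int) : Prop := EdgeChain {
  chain_edge : forall n, edge_data l s (v n) (c n) (e n);
  chain_pos : forall n, 0 < d n;
  chain_vertex : forall n, v n.+1 = v n + c n *: e n;
  chain_direction : forall n, e n.+1 = e n - d n *: v n.+1 }.

Lemma edge_chain_exists (l : nat) (s : seq 'rV[int]_2) :
  reflexive_polygon l (lattice_hull s) ->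
  exists v e c d, edge_chain l s v e c d.
Proof.
move=> hP; have [l0 _ hO _ _] := hP.
have [|x xs _] := conv_interior s (vec2 1 0) hO.
  apply/eqP => h; have := congr1 (fun z : 'rV_2 => z 0 0) h.
  by rewrite vec2E mxE.
have [u [v huv]] := strict_max_exists s x xs.
have [c [e E0]] := edge_data_exists l s u v hP huv.
pose T := ('rV[int]_2 * int * 'rV[int]_2)%type.
pose ok (p : T) := edge_data l s p.1.1 p.1.2 p.2.
(* Guarding the relation by [ok p] makes it total, as dependent choice requires. *)
pose step (p q : T) := ok p -> ok q /\ q.1.1 = p.1.1 + p.1.2 *: p.2.
have [|f [f0 hf]] := @dependent_choice T step _ ((v, c), e).
  move=> p; apply: cid; case: (pselect (ok p)) => [kp|nk]; last by exists p.
  have [u' hu'] := stop_vertex _ _ _ _ _ kp.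
  have [c' [e' E']] := edge_data_exists l s u' _ hP hu'.
  by exists ((p.1.1 + p.1.2 *: p.2, c'), e').
have kf n : ok (f n).
  by elim: n => [|n IH]; [rewrite f0 | have [] := hf n IH].
have vf n : (f n.+1).1.1 = (f n).1.1 + (f n).1.2 *: (f n).2.
  by have [_] := hf n (kf n).
have /choice[d hd] n : exists d : int,
    0 < d /\ (f n.+1).2 = (f n).2 - d *: (f n.+1).1.1.
  have := kf n.+1; rewrite /ok vf => E'.
  by have [d] := edge_data_next _ _ _ _ _ _ _ l0 (kf n) E'; exists d.
exists (fun n => (f n).1.1), (fun n => (f n).2), (fun n => (f n).1.2), d.
by split=> // n; have [] := hd n.
Qed.

Lemma edge_data_le (l : nat) (s : seq 'rV[int]_2) (v e w : 'rV[int]_2)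
    (c : int) :
  edge_data l s v c e -> w \in s -> det2 w e <= l%:Z.
Proof.
move=> E ws; have := edge_support _ _ _ _ _ E _ (lattice_hull_mem _ _ ws).
by rewrite det2_ratv -[l%:R]/(l%:Z%:~R) ler_int.
Qed.

(** A negative [x] places the vertex beyond the line through the origin parallel to edge [n]. Either
    [v n.+2] qualifies, or [c n.+1] and [d n] are both 1 and [v n.+3] does. *)
Lemma edge_chain_opposite (l : nat) (s : seq 'rV[int]_2)
    (v e : nat -> 'rV[int]_2) (c d : nat -> int) (n : nat) :
  edge_chain l s v e c d ->
  exists (x y : int) (m : nat), x < 0 /\ v m = x *: v n + y *: e n.
Proof.
move=> [E dp hv he].
have e1 : e n.+1 = (- d n) *: v n + (1 - d n * c n) *: e n.
  by rewrite he hv; apply/rowP => j; rewrite !mxE; ring.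
have v2 : v n.+2 = (1 - c n.+1 * d n) *: v n +
    (c n + c n.+1 * (1 - d n * c n)) *: e n.
  by rewrite hv e1 hv; apply/rowP => j; rewrite !mxE; ring.
have [neg|pos] := ltP (1 - c n.+1 * d n) 0.
  by do 2 eexists; exists n.+2; split; [exact: neg | exact: v2].
have c1 := length_pos _ _ _ _ _ (E n.+1).
have z : 1 - c n.+1 * d n = 0 by have := dp n; nia.
have d1 : d n = 1 by have := dp n; nia.
exists (- c n.+2), (c n + c n.+1 * (1 - d n * c n) + c n.+2 * (1 - d n * c n -
  d n.+1 * (c n + c n.+1 * (1 - d n * c n)))), n.+3.
split; first by have := length_pos _ _ _ _ _ (E n.+2); lia.
rewrite hv he v2 z e1 d1; apply/rowP => j; rewrite !mxE; ring.
Qed.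

(** [edge_arith] is applied in the basis [v n.+1, e n.+1]: the neighbouring edges, tested on an
    opposite vertex, give its inequalities, and primitivity of vertices and directions gives its
    residues. *)
Lemma edge_chain_length (k : nat) (s : seq 'rV[int]_2)
    (v e : nat -> 'rV[int]_2) (c d : nat -> int) (n : nat) :
  (0 < 3 * k)%N -> edge_chain (3 * k) s v e c d ->
  c n.+1 = 1 /\ exists h, e n.+1 = v n.+1 + 3 *: h.
Proof.
move=> l0 C; have [E dp hv he] := C.
have [x [y [m [x0 hm]]]] := edge_chain_opposite _ _ _ _ _ _ n.+1 C.
have uv i := start_unimodular _ _ _ _ _ (E i).
have ue i := direction_unimodular _ _ _ _ _ (E i).
have hD i := edge_height _ _ _ _ _ (E i).
have [r [h [hr er hn]]] := residue_mod3 _ _ _ (uv n.+1) (ue n.+1) (hD n.+1).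
have e0 : e n = d n *: v n.+1 + 1 *: e n.+1.
  by rewrite he; apply/rowP => j; rewrite !mxE; ring.
have v2 : v n.+2 = 1 *: v n.+1 + c n.+1 *: e n.+1 by rewrite hv scale1r.
have e2 : e n.+2 = (- d n.+1) *: v n.+1 + (1 - d n.+1 * c n.+1) *: e n.+1.
  by rewrite he v2; apply/rowP => j; rewrite !mxE; ring.
have b0 := edge_data_le _ _ _ _ _ _ (E n) (start_mem _ _ _ _ _ (E m)).
have b2 := edge_data_le _ _ _ _ _ _ (E n.+2) (start_mem _ _ _ _ _ (E m)).
have lp : 0 < (3 * k)%N%:Z by [].
have cancel a : a * (3 * k)%N%:Z <= (3 * k)%N%:Z -> a <= 1.
  by rewrite -[leRHS]mul1r ler_pM2r.
move: b0 b2; rewrite hm e0 e2 !det2_comb !hD => /cancel b0 /cancel b2.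
have [c1 r1] : c n.+1 = 1 /\ r = 1.
  apply: (@edge_arith (c n.+1) (d n.+1) (d n) x y r) => //.
  - exact: length_pos (E n.+1).
  - by move: b0; rewrite mulr1 [y * _]mulrC.
  - by move: b2; rewrite mulrN opprK [y * _]mulrC.
  - by move=> t; apply: hn; rewrite -v2.
  - by move=> t; rewrite -[r]mul1r; apply: hn; rewrite -e0.
  - by move=> t; apply: hn; rewrite -e2.
  - by move=> t; apply: hn; rewrite -hm.
by split=> //; exists h; rewrite {1}er r1 scale1r.
Qed.

(** Modulo 3 each [e] equals its [v], so [v n.+2] is twice [v n.+1]. The direction recurrence then
    yields [2 * d n.+1 + 1] congruent to 0. *)
Lemma edge_chain_turn_mod3 (k : nat) (s : seq 'rV[int]_2)
    (v e : nat -> 'rV[int]_2) (c d : nat -> int) (n : nat) :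
  (0 < 3 * k)%N -> edge_chain (3 * k) s v e c d ->
  exists2 q, 0 <= q & d n.+1 = 3 * q + 1.
Proof.
move=> l0 C; have [E dp hv he] := C.
have [c1 [h1 e1]] := edge_chain_length _ _ _ _ _ _ n l0 C.
have [_ [h2 e2]] := edge_chain_length _ _ _ _ _ _ n.+1 l0 C.
have [a ha] := start_unimodular _ _ _ _ _ (E n.+1).
have v2 : v n.+2 = 2 *: v n.+1 + 3 *: h1.
  by rewrite hv c1 e1; apply/rowP => j; rewrite !mxE; ring.
have key : (2 * d n.+1 + 1) *: v n.+1 =
    3 *: (h1 - h2 - (1 + d n.+1) *: h1).
  have := he n.+1; rewrite {1}e2 v2 e1.
  move=> /rowP h; apply/rowP => j; have := h j; rewrite !mxE; lra.
have := congr1 (dot2 a) key.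
rewrite (_ : dot2 a _ = (2 * d n.+1 + 1) * dot2 a (v n.+1)); last first.
  by rewrite /dot2 !mxE; ring.
rewrite ha mulr1 (_ : dot2 a _ = 3 * dot2 a (h1 - h2 - (1 + d n.+1) *: h1));
  last by rewrite /dot2 !mxE; ring.
move: (dot2 a _) => t ht; have := dp n.+1.
exists (d n.+1 - t); lia.
Qed.

(** If [q] is positive, the first inequality, [9 * q * q' - 3 * q' <= 2], forces [q' = 0]; the
    second becomes [3 * q * d <= 2], which is absurd. *)
Lemma turn_arith (q q' d : int) :
  0 <= q -> 0 <= q' -> 0 < d ->
  (1 - (3 * q + 1)) * (1 - (3 * q' + 1)) - (3 * q' + 1) <= 1 ->
  (1 - (3 * q + 1)) * (1 - (3 * q' + 1) + d * (3 * q' + 1 - 2)) -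
    (3 * q' + 1 + d * (1 - (3 * q' + 1))) <= 1 -> q = 0.
Proof.
move=> q0 q0' d0 h1 h2; have [//|q1] := eqVneq q 0.
have z : q' = 0 by nia.
by subst q'; nia.
Qed.

(** A turn of at least 4 at [v n.+4] would push [v n.+5] across the support line of edge [n.+1] or
    [n.+2]. Everything is computed in the basis [v n.+4, e n.+3]. *)
Lemma edge_chain_turn (k : nat) (s : seq 'rV[int]_2)
    (v e : nat -> 'rV[int]_2) (c d : nat -> int) (n : nat) :
  (0 < 3 * k)%N -> edge_chain (3 * k) s v e c d -> d n.+3 = 1.
Proof.
move=> l0 C; have [E dp hv he] := C.
have c1 i : c i.+1 = 1 by have [] := edge_chain_length _ _ _ _ _ _ i l0 C.
have [q q0 dq] := edge_chain_turn_mod3 _ _ _ _ _ _ n.+2 l0 C.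
have [q' q0' dq'] := edge_chain_turn_mod3 _ _ _ _ _ _ n.+1 l0 C.
have {}hv i : v i.+2 = v i.+1 + e i.+1 by rewrite hv c1 scale1r.
pose p := v n.+4; pose f := e n.+3.
have pf : det2 p f = (3 * k)%N%:Z.
  rewrite -(edge_height _ _ _ _ _ (E n.+3)) /p /f (hv n.+2) /det2 !mxE; ring.
have v3 : v n.+3 = p - f by rewrite /p /f (hv n.+2) addrK.
have e2 : e n.+2 = d n.+2 *: p + (1 - d n.+2) *: f.
  have -> : e n.+2 = f + d n.+2 *: v n.+3 by rewrite /f (he n.+2) subrK.
  by rewrite v3; apply/rowP => j; rewrite !mxE; ring.
have v2 : v n.+2 = (1 - d n.+2) *: p + (d n.+2 - 2) *: f.
  have -> : v n.+2 = v n.+3 - e n.+2 by rewrite (hv n.+1) addrK.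
  by rewrite v3 e2; apply/rowP => j; rewrite !mxE; ring.
have e1 : e n.+1 = (d n.+2 + d n.+1 * (1 - d n.+2)) *: p +
    (1 - d n.+2 + d n.+1 * (d n.+2 - 2)) *: f.
  have -> : e n.+1 = e n.+2 + d n.+1 *: v n.+2 by rewrite (he n.+1) subrK.
  by rewrite v2 e2; apply/rowP => j; rewrite !mxE; ring.
have v5 : v n.+1.+4 = (1 - d n.+3) *: p + 1 *: f.
  by rewrite (hv n.+3) (he n.+3) -/p -/f; apply/rowP => j; rewrite !mxE; ring.
have cancel a : a * (3 * k)%N%:Z <= (3 * k)%N%:Z -> a <= 1.
  by rewrite -[leRHS]mul1r ler_pM2r.
have b2 := edge_data_le _ _ _ _ _ _ (E n.+2) (start_mem _ _ _ _ _ (E n.+1.+4)).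
have b1 := edge_data_le _ _ _ _ _ _ (E n.+1) (start_mem _ _ _ _ _ (E n.+1.+4)).
move: b1 b2; rewrite v5 e1 e2 !det2_comb !pf => /cancel b1 /cancel b2.
rewrite dq' dq !mul1r in b1 b2.
by rewrite dq (turn_arith _ _ _ q0 q0' (dp n.+1) b2 b1).
Qed.

(** * The hexagon as an intersection of three strips *)

Definition hex_strip (v e : 'rV[rat]_2) (l : rat) : set 'rV[rat]_2 :=
  [set x | [/\ `|det2 x e| <= l, `|det2 x v| <= l & `|det2 x (v + e)| <= l]].

Definition convex_set (C : set 'rV[rat]_2) : Prop :=
  forall x y t, C x -> C y -> 0 <= t <= 1 -> C ((1 - t) *: x + t *: y).

Lemma convex_triangle (C : set 'rV[rat]_2) (x y : 'rV[rat]_2) (a b : rat) :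
  convex_set C -> C 0 -> C x -> C y -> 0 <= a -> 0 <= b -> a + b <= 1 ->
  C (a *: x + b *: y).
Proof.
move=> hC C0 Cx Cy a0 b0 ab.
have [z|nz] := eqVneq (a + b) 0.
  have [-> ->] : a = 0 /\ b = 0 by split; lra.
  by rewrite !scale0r addr0.
have p : 0 < a + b by rewrite lt0r nz addr_ge0.
have -> : a *: x + b *: y = (1 - (a + b)) *: 0 +
    (a + b) *: ((1 - b / (a + b)) *: x + (b / (a + b)) *: y).
  rewrite scaler0 add0r scalerDr !scalerA mulrBr mulr1.
  by rewrite [_ * (b / _)]mulrC divfK // addrK.
apply: (hC) => //; last by rewrite addr_ge0.
apply: (hC) => //; rewrite divr_ge0 ?addr_ge0 //=.
by rewrite ler_pdivrMr // mul1r lerDr.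
Qed.

(** In coordinates [a, b] with respect to [v, e], the signs of [a], [b] and [b - a] cut the hexagon
    into six triangles, each spanned by the origin and two consecutive vertices. *)
Lemma hex_strip_sub (C : set 'rV[rat]_2) (v e : 'rV[rat]_2) (l : rat) :
  0 < l -> det2 v e = l -> convex_set C ->
  C v -> C (- v) -> C e -> C (- e) -> C (v + e) -> C (- (v + e)) ->
  hex_strip v e l `<=` C.
Proof.
move=> l0 hl hC Cv Cv' Ce Ce' Cs Cs' x [].
have C0 : C 0.
  have -> : 0 = (1 - 1 / 2) *: v + (1 / 2) *: (- v) :> 'rV[rat]_2.
    by apply/rowP => j; rewrite !mxE; field.
  by apply: (hC) => //; lra.
have tri y z a b u : C y -> C z -> 0 <= a -> 0 <= b -> a + b <= 1 ->
    u = a *: y + b *: z -> C u.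
  by move=> *; subst u; apply: convex_triangle.
pose a := det2 x e / l; pose b := - det2 x v / l.
have ln : l != 0 by rewrite gt_eqF.
have ae : det2 x e = a * l by rewrite /a divfK.
have be : det2 x v = - b * l by rewrite /b mulNr divfK // opprK.
have xE : x = a *: v + b *: e.
  apply: row2P; rewrite !mxE /a /b; apply: (mulfI ln).
    transitivity (det2 v e * x 0 0); first by rewrite hl.
    by rewrite mulrDr !mulrA ![l * _ / _]mulrC !mulKf // /det2; ring.
  transitivity (det2 v e * x 0 1); first by rewrite hl.
  by rewrite mulrDr !mulrA ![l * _ / _]mulrC !mulKf // /det2; ring.
have se : det2 x (v + e) = (a - b) * l.
  by rewrite mulrBl -ae -[b * l]opprK -mulNr -be /det2 !mxE; ring.
have cancel t : `|t * l| <= l -> - 1 <= t <= 1.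
  by rewrite normrM (gtr0_norm l0) -[leRHS]mul1r ler_pM2r // ler_norml.
rewrite se be ae => /cancel/andP[a0 a1] /cancel/andP[b0 b1] /cancel/andP[s0 s1].
have [ha|ha] := leP 0 a; have [hb|hb] := leP 0 b;
  have [hab|hab] := leP a b.
- apply: (tri _ _ a (b - a) x Cs Ce); [lra | lra | lra |].
  by rewrite xE; apply/rowP => j; rewrite !mxE; ring.
- apply: (tri _ _ b (a - b) x Cs Cv); [lra | lra | lra |].
  by rewrite xE; apply/rowP => j; rewrite !mxE; ring.
- by lra.
- apply: (tri _ _ a (- b) x Cv Ce'); [lra | lra | lra |].
  by rewrite xE; apply/rowP => j; rewrite !mxE; ring.
- apply: (tri _ _ (- a) b x Cv' Ce); [lra | lra | lra |].
  by rewrite xE; apply/rowP => j; rewrite !mxE; ring.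
- by lra.
- apply: (tri _ _ (- b) (b - a) x Cs' Cv'); [lra | lra | lra |].
  by rewrite xE; apply/rowP => j; rewrite !mxE; ring.
apply: (tri _ _ (- a) (a - b) x Cs' Ce'); [lra | lra | lra |].
by rewrite xE; apply/rowP => j; rewrite !mxE; ring.
Qed.

Lemma reflexive_hex_strip (k : nat) (s : seq 'rV[int]_2) :
  reflexive_polygon (3 * k) (lattice_hull s) ->
  exists v e, [/\ unimodular v, unimodular e, det2 v e = (3 * k)%N%:Z &
    lattice_hull s = hex_strip (ratv v) (ratv e) (3 * k)%N%:R /\
    [/\ lattice_hull s (ratv v), lattice_hull s (ratv e) &
        lattice_hull s (ratv (v + e))] /\
    [/\ lattice_hull s (ratv (- v)), lattice_hull s (ratv (- e)) &
        lattice_hull s (ratv (- (v + e)))]].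
Proof.
move=> hP; have [l0 _ _ _ _] := hP.
have [v [e [c [d C]]]] := edge_chain_exists _ _ hP; have [E _ hv he] := C.
have c1 i : c i.+1 = 1 by have [] := edge_chain_length _ _ _ _ _ _ i l0 C.
(* Lengths are 1 from index 1 on and turns from index 3 on, so the closed hexagon is read off
   starting at index 3. *)
have {}he i : e i.+4 = - v i.+3.
  rewrite he (edge_chain_turn _ _ _ _ _ _ _ l0 C) hv c1 !scale1r.
  by rewrite opprD addrCA subrr addr0.
have {}hv i : v i.+2 = v i.+1 + e i.+1 by rewrite hv c1 scale1r.
pose p := v 3; pose f := e 3.
have v4 : v 4 = p + f by rewrite hv.
have v5 : v 5 = f by rewrite hv he v4 /p addrAC subrr add0r.
have v6 : v 6 = - p by rewrite hv he v4 v5 opprD addrCA subrr addr0.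
have v7 : v 7 = - (p + f) by rewrite hv he v5 v6 opprD.
have v8 : v 8 = - f by rewrite hv he v6 v7 opprK opprD addrAC addNr add0r.
have e4 : e 4 = - p by rewrite he.
have e5 : e 5 = - (p + f) by rewrite he v4.
have e6 : e 6 = - f by rewrite he v5.
have e7 : e 7 = p by rewrite he v6 opprK.
have e8 : e 8 = p + f by rewrite he v7 opprK.
have Hv i := lattice_hull_mem s (v i) (start_mem _ _ _ _ _ (E i)).
have He i := edge_support _ _ _ _ _ (E i).
exists p, f; split.
- exact: start_unimodular (E 3).
- exact: direction_unimodular (E 3).
- exact: edge_height (E 3).
split; last first.
  split; split; [exact: (Hv 3) | rewrite -v5 | rewrite -v4 | rewrite -v6 |
    rewrite -v8 | rewrite -v7]; exact: Hv.
have rN x : ratv (- x) = - ratv x by apply/rowP => j; rewrite !mxE rmorphN.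
have rD x y : ratv (x + y) = ratv x + ratv y.
  by apply/rowP => j; rewrite !mxE rmorphD.
(* Opposite edges bound the absolute values; conversely the six vertices and convexity fill the
   hexagon. *)
apply/seteqP; split=> x.
  have dN y : det2 x (- y) = - det2 x y by rewrite /det2 !mxE; ring.
  move=> Px; split; rewrite ler_norml lerNl -dN -?rD -?rN.
  - by rewrite -e6 !He.
  - by rewrite -e4 -e7 !He.
  by rewrite -e5 -e8 !He.
apply: hex_strip_sub; rewrite -?rD -?rN.
- by rewrite ltr0n.
- by rewrite det2_ratv (edge_height _ _ _ _ _ (E 3)).
- by move=> y z t; apply: conv_comb.
- exact: Hv.
- by rewrite -v6; apply: Hv.
- by rewrite -v5; apply: Hv.
- by rewrite -v8; apply: Hv.
- by rewrite -v4; apply: Hv.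
by rewrite -v7; apply: Hv.
Qed.

(** * Linear images and lattice isomorphisms *)

Lemma sum2E {R : pzRingType} (f : 'I_2 -> R) : \sum_i f i = f 0 + f 1.
Proof.
rewrite !big_ord_recl big_ord0 addr0.
by rewrite (_ : lift ord0 ord0 = 1) //; apply/val_inj.
Qed.

Lemma mulmx2E {R : pzRingType} (x : 'rV[R]_2) (A : 'M[R]_2) (j : 'I_2) :
  (x *m A) 0 j = x 0 0 * A 0 j + x 0 1 * A 1 j.
Proof. by rewrite mxE sum2E. Qed.

Lemma mat2E {R : Type} (a b c d : R) :
  ((mat2 a b c d 0 0 = a) * (mat2 a b c d 0 1 = b)) *
  ((mat2 a b c d 1 0 = c) * (mat2 a b c d 1 1 = d)).
Proof. by split; split; rewrite !mxE. Qed.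

Lemma det2_mul {R : comPzRingType} (x y : 'rV[R]_2) (A : 'M[R]_2) :
  det2 (x *m A) (y *m A) = (A 0 0 * A 1 1 - A 0 1 * A 1 0) * det2 x y.
Proof. rewrite /det2 !mulmx2E; ring. Qed.

Lemma det_mx2E {R : comPzRingType} (A : 'M[R]_2) :
  \det A = A 0 0 * A 1 1 - A 0 1 * A 1 0.
Proof.
rewrite (expand_det_row _ 0) sum2E /cofactor !det_mx11 !mxE /=.
rewrite (_ : lift 0 0 = 1); last by apply/val_inj.
rewrite (_ : lift 1 0 = 0); last by apply/val_inj.
by rewrite expr0 expr1; ring.
Qed.

Lemma pairing_mul (u x : 'rV[rat]_2) (A : 'M[rat]_2) : A \in unitmx ->
  pairing (u *m (invmx A)^T) (x *m A) = pairing u x.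
Proof.
move=> uA; have E (y z : 'rV[rat]_2) : pairing y z = (y *m z^T) 0 0.
  by rewrite /pairing mxE; apply: eq_bigr => j _; rewrite mxE.
by rewrite !E trmx_mul mulmxA -(mulmxA u) -trmx_mul mulmxV // trmx1 mulmx1.
Qed.

Lemma vertex_mul (P : set 'rV[rat]_2) (A : 'M[rat]_2) (v : 'rV[rat]_2) :
  A \in unitmx -> vertex P v -> vertex [set x *m A | x in P] (v *m A).
Proof.
move=> uA [u [c [h1 h2]]]; exists (u *m (invmx A)^T), c; split.
  by move=> _ [x Px <-]; rewrite pairing_mul //; apply: h1.
apply/seteqP; split=> [_ ->|_ [[x Px <-]]] /=; rewrite pairing_mul //.
  have : (P `&` [set x | pairing u x = c]) v by rewrite -h2.
  by case=> Pv e; split=> //; exists v.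
move=> e; have : (P `&` [set x | pairing u x = c]) x by [].
by rewrite -h2 => ->.
Qed.

Lemma isomorphic_linear (P : set 'rV[rat]_2) (A : 'M[int]_2) :
  A \in unitmx -> isomorphic P [set x *m map_mx intr A | x in P].
Proof.
move=> uA; exists A, 0; split=> //.
have uB : (map_mx intr A : 'M[rat]_2) \in unitmx.
  by rewrite unitmxE det_map_mx rmorph_unit // -unitmxE.
set B : 'M[rat]_2 := map_mx intr A in uB *.
have r0 : ratv 0 = 0 by apply/rowP => j; rewrite !mxE.
apply/seteqP; split=> [x hx|_ [v hv <-]]; rewrite ?r0 ?addr0; last first.
  exact: vertex_mul.
exists (x *m invmx B); last by rewrite /= addr0 mulmxKV.
have := vertex_mul _ (invmx B) x _ hx; rewrite unitmx_inv => /(_ uB).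
congr vertex; apply/seteqP; split=> [_ [_ [y Py <-] <-]|y Py].
  by rewrite mulmxK.
by exists (y *m B); [exists y | rewrite mulmxK].
Qed.

(** A linear map multiplies [det2] by its determinant, which rescales the width of the strips. *)
Lemma hex_strip_mul (v e : 'rV[rat]_2) (l : rat) (A : 'M[rat]_2) :
  A \in unitmx ->
  [set x *m A | x in hex_strip v e l] =
    hex_strip (v *m A) (e *m A) (`|\det A| * l).
Proof.
move=> uA; have dA : 0 < `|\det A|.
  by rewrite normr_gt0 -unitfE -unitmxE.
have E x : hex_strip (v *m A) (e *m A) (`|\det A| * l) (x *m A) <->
    hex_strip v e l x.
  by rewrite /hex_strip /= -mulmxDl !det2_mul -!det_mx2E !normrM !ler_pM2l.
apply/seteqP; split=> [_ [x hx <-]|x]; first exact/E.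
by rewrite -[x](mulmxKV uA) => /E; exists (x *m invmx A).
Qed.

Lemma hex_stripC (v e : 'rV[rat]_2) (l : rat) :
  hex_strip v e l = hex_strip e v l.
Proof.
by apply/seteqP; split=> x [h1 h2 h3]; split=> //; rewrite addrC.
Qed.

Lemma hexagonE : hexagon = hex_strip (vec2 1 0) (vec2 0 1) 1.
Proof.
have sE : vec2 1 0 + vec2 0 1 = vec2 1 1 :> 'rV[rat]_2.
  by apply: row2P; rewrite !mxE /=; ring.
apply/seteqP; split=> x.
  have dN y : det2 x (- y) = - det2 x y by rewrite /det2 !mxE; ring.
  have dE (z y : 'rV[rat]_2) : det2 z y = dot2 (vec2 (y 0 1) (- y 0 0)) z.
    by rewrite /det2 /dot2 !vec2E; ring.
  have half y : (forall p, p \in [:: vec2 0 1; - vec2 0 1; vec2 1 1;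
      - vec2 1 1; vec2 1 0; - vec2 1 0] -> det2 p y <= 1) -> hexagon x ->
      det2 x y <= 1.
    by move=> h; rewrite dE; apply: conv_le => p /h; rewrite dE.
  move=> hx; rewrite /hex_strip /= sE.
  by split; rewrite ler_norml lerNl -dN; apply/andP; split; apply: half => // p;
    rewrite !inE => /or4P[|||/or3P[||]] /eqP ->; rewrite /det2 !mxE /=; lra.
have in6 p : p \in [:: vec2 0 1; - vec2 0 1; vec2 1 1; - vec2 1 1; vec2 1 0;
    - vec2 1 0 : 'rV[rat]_2] -> hexagon p by apply: conv_mem.
apply: hex_strip_sub => //.
- by rewrite /det2 !vec2E; ring.
- by move=> y z t; apply: conv_comb.
all: by apply: in6; rewrite ?sE !inE eqxx ?orbT.
Qed.

(** * Self-duality of the hexagon *)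

(** The quarter turn converts [pairing] into [det2], so it is enough that [P] is its own polar for
    [det2] at level [l]. Testing [det2 x z <= l] on the six vertices [x] gives exactly the strip
    inequalities for [z]. *)
Lemma hex_strip_dual (P : set 'rV[rat]_2) (v e : 'rV[rat]_2) (l : rat) :
  0 < l -> det2 v e = l -> P = hex_strip v e l -> convex_set P ->
  [/\ P v, P e & P (v + e)] -> [/\ P (- v), P (- e) & P (- (v + e))] ->
  [set l *: y | y in dual P] = [set x *m mat2 0 (-1) 1 0 | x in P].
Proof.
move=> l0 hl PE cP [Pv Pe Ps] [Pv' Pe' Ps'].
have dJ x z : pairing (z *m mat2 0 (-1) 1 0) x = det2 x z.
  by rewrite pairingE /dot2 /det2 !mulmx2E !mat2E; ring.
have dN (x z : 'rV[rat]_2) : det2 (- x) z = - det2 x z.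
  by rewrite /det2 !mxE; ring.
have dC (x z : 'rV[rat]_2) : det2 x z = - det2 z x by rewrite /det2; ring.
have polar z : P z <-> forall x, P x -> det2 x z <= l.
  split=> [Pz x|h].
    move: Pz; rewrite {1}PE => -[]; rewrite ![det2 z _]dC !normrN !ler_norml.
    move=> /andP[e0 e1] /andP[v0 v1] /andP[s0 s1]; rewrite PE => hx.
    have := @hex_strip_sub [set y | det2 y z <= l] v e l l0 hl.
    apply=> //=; rewrite ?dN; try by rewrite lerNl.
    move=> y1 y2 t /= h1 h2 /andP[t0 t1].
    rewrite (_ : det2 _ z = (1 - t) * det2 y1 z + t * det2 y2 z); last first.
      by rewrite /det2 !mxE; ring.
    nra.
  rewrite PE; split; rewrite dC normrN ler_norml lerNl -dN;
    by rewrite !h.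
apply/seteqP; split=> [_ [y hy <-]|_ [z /polar hz <-]].
  exists (l *: y *m mat2 0 1 (-1) 0); last first.
    by apply: row2P; rewrite !mulmx2E !mat2E; ring.
  apply/polar => x Px; rewrite -dJ (_ : pairing _ _ = l * pairing y x).
    by rewrite ger_pMr //; apply: hy.
  by rewrite !pairingE /dot2 !mulmx2E !mat2E !mxE; ring.
exists (l^-1 *: (z *m mat2 0 (-1) 1 0)); last first.
  by rewrite scalerA mulfV ?scale1r // gt_eqF.
move=> x Px; rewrite (_ : pairing _ _ = l^-1 * det2 x z); last first.
  by rewrite -dJ !pairingE /dot2 !mxE; ring.
by rewrite mulrC ler_pdivrMr // mul1r; apply: hz.
Qed.

(** * The normal form and the scaled dual *)

Theorem proposition2p16 (k : nat) (P : set 'rV[rat]_2)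
    (hk : odd k) (hP : reflexive_polygon (3 * k) P) :
  (exists i : nat,
     [/\ (0 < i < 3 * k)%N, coprime i (3 * k) &
         isomorphic P
           [set x *m mat2 (3 * k)%:R i%:R 0 1 | x in hexagon]]) /\
  isomorphic P [set (3 * k)%:R *: y | y in dual P].
Proof.
have [l0 [s Ps] _ _ _] := hP.
have {}Ps : P = lattice_hull s by [].
subst P; have [v [e [uv ue hve [PE [Pp Pn]]]]] := reflexive_hex_strip k s hP.
have rN x : ratv (- x) = - ratv x by apply/rowP => j; rewrite !mxE rmorphN.
have rD x y : ratv (x + y) = ratv x + ratv y.
  by apply/rowP => j; rewrite !mxE rmorphD.
rewrite !rN !rD in Pp Pn.
have rhve : det2 (ratv v) (ratv e) = (3 * k)%N%:R by rewrite det2_ratv hve.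
have rl0 : 0 < (3 * k)%N%:R :> rat by rewrite ltr0n.
split; last first.
  rewrite (hex_strip_dual _ _ _ _ rl0 rhve PE) //; last first.
    by move=> x y t; apply: conv_comb.
  rewrite (_ : mat2 0 (-1) 1 0 = map_mx intr (mat2 0 (-1) 1 0 : 'M[int]_2)).
    by apply: isomorphic_linear; rewrite unitmxE det_mx2E !mat2E.
  by apply/matrixP => i j; rewrite !mxE; do 2 case: ifP => _; rewrite ?mxE //=;
    case: ifP.
have [a ha] := uv.
(* The shear [i] is [dot2 a e] reduced modulo [l]; the quotient [t] is absorbed into the second
   basis vector. *)
pose l := (3 * k)%N; pose m := dot2 a e.
pose t := (m %/ l%:Z)%Z.
have lZ : l%:Z != 0 by rewrite eqz_nat -lt0n.
have [i hi] : exists i : nat, (m %% l%:Z)%Z = i%:Z.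
  by exists `|(m %% l%:Z)%Z|%N; rewrite gez0_abs // modz_ge0.
have hm : m = t * l%:Z + i%:Z by rewrite -hi; apply: divz_eq.
have il : (i < l)%N by rewrite -ltz_nat -hi ltz_pmod.
(* [g] completes [v] to a basis of the lattice in which [e] is [l g + i v]. *)
have [g gE] : exists g, g = vec2 (- a 0 1 + t * v 0 0) (a 0 0 + t * v 0 1).
  by eexists.
have vg : det2 v g = 1 by rewrite -ha gE /det2 /dot2 !vec2E; ring.
have eg : e = l%:Z *: g + i%:Z *: v.
  have iE : i%:Z = m - t * l%:Z by rewrite hm addrAC subrr add0r.
  apply: row2P; rewrite gE ![in RHS]mxE iE /= -hve /m.
    transitivity (dot2 a v * e 0 0); first by rewrite ha mul1r.
    by rewrite /dot2 /det2; ring.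
  transitivity (dot2 a v * e 0 1); first by rewrite ha mul1r.
  by rewrite /dot2 /det2; ring.
(* A common divisor of [i] and [l] divides the primitive vector [e]. *)
have cop : coprime i l.
  have [b hb] := ue.
  have [p hp] := dvdnP (dvdn_gcdl i l); have [q hq] := dvdnP (dvdn_gcdr i l).
  have iE : i%:Z = p%:Z * (gcdn i l)%:Z by rewrite -PoszM -hp.
  have lE : l%:Z = q%:Z * (gcdn i l)%:Z by rewrite -PoszM -hq.
  have : (gcdn i l)%:Z * dot2 b (q%:Z *: g + p%:Z *: v) = 1.
    by rewrite -hb eg iE lE /dot2 !mxE; ring.
  rewrite /coprime; move: (gcdn i l) (dot2 b _) => x y hxy.
  by rewrite -[x]/`|x%:Z|%N -dvdz1; apply/dvdzP; exists y; rewrite mulrC.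
have i0 : (0 < i)%N.
  rewrite lt0n; apply/eqP => z; move: cop.
  by rewrite z /coprime gcd0n /l; lia.
exists i; split=> //; first by rewrite i0.
(* [A] takes coordinates in the basis [g, v], so [e] goes to [(l, i)] and [v] to [(0, 1)], the rows
   of the required matrix. *)
pose A : 'M[int]_2 := mat2 (- v 0 1) (g 0 1) (v 0 0) (- g 0 0).
have dA : \det A = -1.
  by rewrite det_mx2E !mat2E -vg /det2; ring.
have uA : A \in unitmx by rewrite unitmxE dA.
have uB : (map_mx intr A : 'M[rat]_2) \in unitmx.
  by rewrite unitmxE det_map_mx rmorph_unit // -unitmxE.
have := isomorphic_linear (lattice_hull s) A uA.
rewrite PE hex_strip_mul // det_map_mx dA /= normrN1 mul1r.
rewrite hexagonE hex_strip_mul; last first.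
  by rewrite unitmxE det_mx2E !mat2E mulr0 subr0 mulr1 unitfE gt_eqF.
rewrite det_mx2E !mat2E mulr0 subr0 !mulr1 gtr0_norm //.
rewrite (hex_stripC (vec2 1 0 *m _)).
have ratM x : ratv x *m map_mx intr A = ratv (x *m A) by rewrite -map_mxM.
rewrite !ratM.
have -> : ratv (e *m A) = vec2 1 0 *m mat2 l%:R i%:R 0 1.
  have -> : e *m A = vec2 l%:Z i%:Z.
    apply: row2P; rewrite mulmx2E !mat2E vec2E.
      by rewrite -hve /det2; ring.
    transitivity (i%:Z * det2 v g); last by rewrite vg mulr1.
    transitivity (det2 e g); first by rewrite /det2; ring.
    rewrite eg /det2 !mxE; ring.
  by apply: row2P; rewrite !mulmx2E !mat2E !mxE /=; ring.
have -> : ratv (v *m A) = vec2 0 1 *m mat2 l%:R i%:R 0 1.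
  have -> : v *m A = vec2 0 1.
    apply: row2P; rewrite mulmx2E !mat2E vec2E; first by ring.
    by rewrite -vg /det2; ring.
  by apply: row2P; rewrite !mulmx2E !mat2E !mxE /=; ring.
by [].
Qed.
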